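(* Let $X$ be a nonempty set and let $\mathcal{A}$ be an arbitrary field of subsets of $X$, with $\mathcal{M}(X,\mathcal{A})$ regarded as a ring under pointwise operations (standing assumption: it is closed under pointwise addition and multiplication). Then the ring $\mathcal{M}(X,\mathcal{A})$ is self-injective if and only if $\mathcal{A}$ is complete (as a Boolean algebra) and $\mathfrak{c}^+$-additive.
   Context: A field of subsets of a nonempty set $X$ is a nonempty family $\mathcal{A}\subseteq\mathcal{P}(X)$ closed under finite unions and complements in $X$; it is a Boolean algebra under the set operations. $\mathcal{M}(X,\mathcal{A})=\{f:X\to\mathbb{R} : f^{-1}(U)\in\mathcal{A}\text{ for every open }U\subseteq\mathbb{R}\}$, with pointwise addition and multiplication inherited from $\mathbb{R}^X$. A commutative ring $R$ with identity is self-injective if for every ideal $I$ of $R$, every $R$-module homomorphism $I\to R$ extends to an $R$-module homomorphism $R\to R$. A Boolean algebra is complete if every nonempty subset has a supremum in it (for a field of sets, this supremum need not be the union). Let $\mathfrak{c}=2^{\aleph_0}$; $\mathcal{A}$ is $\mathfrak{c}^+$-additive if $\bigcup_{i\in I}A_i\in\mathcal{A}$ for every family $\{A_i:i\in I\}$ in $\mathcal{A}$ with $|I|\le\mathfrak{c}$. *)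

(* Defs.v *)
From HB Require Import structures.
From mathcomp Require Import all_boot all_order all_algebra.
From mathcomp Require Import all_classical all_reals all_analysis.

Set Implicit Arguments.
Unset Strict Implicit.
Unset Printing Implicit Defensive.

Import GRing.Theory.
Import numFieldNormedType.Exports.

Local Open Scope classical_set_scope.
Local Open Scope ring_scope.

(* An ideal of the commutative ring R is a submodule I of the regular module
   R^o; [ideal_module I] is I regarded as an R-module in its own right. *)
Definition ideal_module (R : comPzRingType) (I : submodClosed R^o) : Type :=
  {x : R^o | x \in I}.

HB.instance Definition _ (R : comPzRingType) (I : submodClosed R^o) :=
  SubChoice.on (ideal_module I).
HB.instance Definition _ (R : comPzRingType) (I : submodClosed R^o) :=
  [SubChoice_isSubLmodule of ideal_module I by <:].

Definition self_injective (R : comPzRingType) : Prop :=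
  forall (I : submodClosed R^o) (phi : {linear ideal_module I -> R^o}),
    exists psi : {linear R^o -> R^o},
      forall x : ideal_module I, psi (val x) = phi x.

Section FieldsOfSets.
Variables (X : Type) (A : set (set X)).

Definition field_of_sets : Prop :=
  [/\ A !=set0, setU_closed A & setC_closed A].

(* The supremum is taken in the poset A, so it need not be the union. *)
Definition is_sup_in (B : set (set X)) (S : set X) : Prop :=
  [/\ A S, forall T, B T -> T `<=` S
    & forall S', A S' -> (forall T, B T -> T `<=` S') -> S `<=` S'].

Definition complete_field_of_sets : Prop :=
  forall B : set (set X), B `<=` A -> B !=set0 -> exists S, is_sup_in B S.

(* [set: set nat] has cardinality 2 ^ aleph_0. *)
Definition continuum_additive : Prop :=
  forall (I : Type) (F : I -> set X), ([set: I] #<= [set: set nat])%card ->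
    (forall i, A (F i)) -> A (\bigcup_i F i).

Variable R : realType.

Definition mfun_field : set (X -> R) :=
  [set f | forall U : set R, open U -> A (f @^-1` U)].

Definition add_closed : Prop :=
  forall f g, mfun_field f -> mfun_field g -> mfun_field (f \+ g).

Definition mul_closed : Prop :=
  forall f g, mfun_field f -> mfun_field g -> mfun_field (f \* g).

Lemma mfun_field_cst (c : R) : field_of_sets -> mfun_field (cst c).
Proof.
move=> [[B AB] AU AC] U _.
have AT : A [set: X] by rewrite -(setUv B); apply: AU => //; exact: AC.
rewrite preimage_cst; case: ifP => // _.
by rewrite -setCT; exact: AC.
Qed.

Lemma mfun_field_subring :
  field_of_sets -> add_closed -> mul_closed ->
  subring_closed [pred f : X -> R | f \in mfun_field].
Proof.
move=> fA addA mulA; split => [|f g|f g]; rewrite !inE.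
- exact: mfun_field_cst.
- move=> Mf Mg; apply: addA => //.
  have -> : - g = cst (-1) \* g by apply/funext => x /=; rewrite mulN1r.
  by apply: mulA => //; exact: mfun_field_cst.
- exact: mulA.
Qed.

(* M(X, A) as a subring of X -> R; the proofs are arguments of the type so
   that the ring structure can be inferred from it. *)
Definition mfun_ring (fA : field_of_sets) (addA : add_closed)
  (mulA : mul_closed) : Type := {f : X -> R | f \in mfun_field}.

Section Ring.
Variables (fA : field_of_sets) (addA : add_closed) (mulA : mul_closed).

HB.instance Definition _ := SubChoice.on (mfun_ring fA addA mulA).
HB.instance Definition _ := GRing.SubChoice_isSubComPzRing.Build _ _
  (mfun_ring fA addA mulA) (mfun_field_subring fA addA mulA).

End Ring.
End FieldsOfSets.

Arguments mfun_field {X} A R.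
Arguments add_closed {X} A R.
Arguments mul_closed {X} A R.
Arguments mfun_ring {X A R} fA addA mulA.

(* Main.v *)
From HB Require Import structures.
Require Import Defs.
From mathcomp Require Import all_boot all_order all_algebra.
From mathcomp Require Import all_classical all_reals all_analysis.
From mathcomp Require Import lra.

Set Implicit Arguments.
Unset Strict Implicit.
Unset Printing Implicit Defensive.

Import Order.TTheory GRing.Theory Num.Theory.
Import numFieldNormedType.Exports.

Local Open Scope classical_set_scope.
Local Open Scope ring_scope.

(** Write M for the ring M(X, A), where X is any set and A a field of subsets.

    From self-injectivity to the two set-theoretic conditions.  Any function
    [h : X -> R] defines an ideal of M, its conductor: the [f] in M such that
    [f * h] is again in M.  Multiplication by [h] is a homomorphism from this
    ideal to M, so self-injectivity yields [g] in M with [f * g = f * h] for all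
    [f] in the conductor.  The conductor contains the indicator of every set of
    A on which [h] is constant, hence [g] agrees with [h] on all such sets
    ([self_injective_patch]): a wild [h] is replaced by a measurable [g].
    - Completeness: for a family B in A, let [h] be the indicator of the union
      of B.  The set [g = 1] contains all members of B; it is contained in every
      upper bound T in A of B, because [h] and so [g] vanish off T.
    - Disjoint unions of a continuum of sets: given disjoint sets [F r] in A,
      one for each real [r], let [h = r] on [F r].  If the supremum S of the
      [F r] contained a point x outside their union, then [F (g x)] removed from
      the fiber of [g] through x would be a set of A containing x and disjoint
      from every [F r], and S could be made smaller.  So S is the union.
    - Arbitrary unions: well-order the index set and make the family disjoint;
      transfinite induction keeps the partial unions in A
      ([field_bigcup_trivIset]).

    Conversely, let [phi : I -> M] be linear on an ideal I.  Its only possible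
    multiplier is the quotient [phi f / f] at a point where some [f] in I does
    not vanish, and this does not depend on [f].  For each real [r], the sets
    where this quotient equals [r], one for each [f], belong to A and have a
    supremum [S r] in A.  Suprema of families that are disjoint from each other
    are disjoint ([sup_in_disjoint]), so [g = r] on [S r] and [g = 0] elsewhere
    defines a function.  It is in M because the preimage of any set of reals is
    a union of at most a continuum of sets of A, up to one complement, and
    multiplication by [g] extends [phi].

    Both directions index families by the reals, which is legitimate since the
    real line and the powerset of nat have the same cardinality
    ([continuum_additiveP]). *)

(** * The cardinality of the real line *)

Section CardReal.
Variable R : realType.

(** A real number is determined by its lower Dedekind cut in the rationals,
    coded as a set of natural numbers. *)
Lemma card_real_le : ([set: R] #<= [set: set nat])%card.
Proof.
apply/pcard_injP; exists (fun r =>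
  [set n | exists2 q : rat, unpickle n = Some q & ratr q < r]).
have cut_lt (r s : R) : r < s ->
    [set n | exists2 q : rat, unpickle n = Some q & ratr q < r] <>
    [set n | exists2 q : rat, unpickle n = Some q & ratr q < s].
  move=> /rat_in_itvoo[q]; rewrite in_itv/= => /andP[rq qs] /seteqP[_].
  move=> /(_ (pickle q)) []; first by exists q => //; rewrite pickleK.
  by move=> q'; rewrite pickleK => -[<-]; rewrite ltNge (ltW rq).
move=> r s _ _ /= eqrs; have [rs|sr|//] := ltgtP r s.
- by case: (cut_lt _ _ rs eqrs).
- by case: (cut_lt _ _ sr (esym eqrs)).
Qed.

Let ternary (S : set nat) (n : nat) : R :=
  \sum_(k < n) ((k : nat) \in S)%:R * 3^-1 ^+ k.

Let ternaryS S n :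
  ternary S n.+1 = ternary S n + (n \in S)%:R * 3^-1 ^+ n.
Proof. by rewrite /ternary big_ord_recr. Qed.

Let ternary_nondecreasing S : nondecreasing_seq (ternary S).
Proof.
by apply/nondecreasing_seqP => n; rewrite ternaryS lerDl mulr_ge0// exprn_ge0.
Qed.

(** The digits of rank at least n contribute at most the tail of a geometric
   series of ratio 1/3, whose sum is 3/2 times its first term. *)
Let ternary_le S m n : ternary S m <= ternary S n + 3/2 * 3^-1 ^+ n.
Proof.
have p0 k : 0 <= 3^-1 ^+ k :> R by rewrite exprn_ge0.
have decr : nonincreasing_seq (fun k => ternary S k + 3/2 * 3^-1 ^+ k).
  apply/nonincreasing_seqP => k; rewrite ternaryS exprS.
  by have := p0 k; case: (_ \in _) => /=; lra.
have [/(ternary_nondecreasing S) le_mn|/ltnW/decr] := leqP m n.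
  by rewrite (le_trans le_mn)// lerDl mulr_ge0.
by apply: le_trans; rewrite lerDl mulr_ge0.
Qed.

(** Sum the powers of 1/3 over the elements of a set: in base 3, a digit 1
    outweighs any sequence of digits 0 and 1 that follows it, so that the first
    element on which two sets differ orders their sums. *)
Lemma card_real_ge : ([set: set nat] #<= [set: R])%card.
Proof.
apply/pcard_injP; exists (fun S => sup (range (ternary S))).
have sup_lt (S T : set nat) n :
    (forall k, (k < n)%N -> (k \in S) = (k \in T)) ->
    n \in S -> n \notin T -> sup (range (ternary T)) < sup (range (ternary S)).
  move=> agree Sn Tn.
  have eqST : ternary S n = ternary T n.
    by apply: eq_bigr => k _; rewrite agree.
  apply: (@le_lt_trans _ _ (ternary T n.+1 + 3/2 * 3^-1 ^+ n.+1)).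
    apply: ge_sup; first by exists (ternary T 0), 0%N.
    by move=> _ [m _ <-]; exact: ternary_le.
  apply: (@lt_le_trans _ _ (ternary S n.+1)); last first.
    apply: ub_le_sup; last by exists n.+1.
    by exists (ternary S 0 + 3/2 * 3^-1 ^+ 0) => _ [m _ <-]; exact: ternary_le.
  rewrite !ternaryS eqST Sn (negbTE Tn) exprS.
  have : 0 < 3^-1 ^+ n :> R by rewrite exprn_gt0.
  by rewrite mul0r mul1r addr0; lra.
move=> S T _ _ /= eq_sup; apply: contrapT => neqST.
have ex_diff : exists n, (n \in S) != (n \in T).
  apply: contrapT => /forallNP noneq; apply: neqST.
  apply/predeqP => n; have /negP := noneq n; rewrite negbK => /eqP eqn.
  by split=> /mem_set; [rewrite eqn|rewrite -eqn] => /set_mem.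
case: (ex_minnP ex_diff) => n diff minn.
have agree k : (k < n)%N -> (k \in S) = (k \in T).
  by move=> lt_kn; apply/eqP; apply: contraTT lt_kn => /minn; rewrite -leqNgt.
have [Sn|Sn] := boolP (n \in S).
  have := sup_lt S T n agree Sn; rewrite eq_sup ltxx.
  by move: diff; rewrite Sn; case: (n \in T) => // _ /(_ isT).
have := sup_lt T S n (fun k lt => esym (agree k lt)).
rewrite eq_sup ltxx Sn.
by move: diff; rewrite (negbTE Sn); case: (n \in T) => // _ /(_ isT isT).
Qed.

End CardReal.

(** * Well-orders *)

(** The well-ordering principle, restated for the strict order. *)
Lemma strict_well_order (J : eqType) : exists lt : rel J,
  [/\ transitive lt, forall i j, i != j -> lt i j || lt j i
    & forall P : set J, P !=set0 -> exists2 i, P i & forall j, lt j i -> ~ P j].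
Proof.
have [le wo] := wochoice.well_ordering_principle J.
have wo_chain : wochoice.wo_chain le predT by exact: wochoice.withinW.
have le_total i j : le i j || le j i by exact: (wochoice.wo_chainW wo_chain).
pose lt i j := ~~ le j i.
have total i j : i != j -> lt i j || lt j i.
  rewrite /lt -negb_and andbC; apply: contraNN => le_ij; apply/eqP.
  exact: (wochoice.wo_chain_antisymmetric wo_chain).
have minimal (P : set J) : P !=set0 ->
    exists2 i, P i & forall j, lt j i -> ~ P j.
  move=> [i0 Pi0]; have [|i [[Pi lei] _]] := wo (mem P).
    by exists i0; exact/mem_set.
  exists i; first exact/set_mem.
  by move=> j + Pj => /negP; apply; apply: lei; exact/mem_set.
exists lt; split => // j i k lt_ij lt_jk.
(* Since [i < j < k], the least element of {i, j, k} can only be [i]. *)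
have [|m m_in minm] := minimal [set l | l \in [:: i; j; k]].
  by exists i; rewrite /= mem_head.
have [eq_ik|/total/orP[//|lt_ki]] := eqVneq i k.
  by move: lt_ij (le_total i j); rewrite eq_ik /lt; move: lt_jk => /negPf-> /negPf->.
move: m_in; rewrite /= !inE => /or3P[] /eqP eq_m; rewrite eq_m in minm.
- by case: (minm _ lt_ki); rewrite /= !inE eqxx !orbT.
- by case: (minm _ lt_ij); rewrite /= mem_head.
- by case: (minm _ lt_jk); rewrite /= !inE eqxx !orbT.
Qed.

(** * Fields of sets *)

Section FieldOfSets.
Variables (X : Type) (A : set (set X)).
Hypothesis fA : field_of_sets A.

Lemma field_setC (S : set X) : A S -> A (~` S).
Proof. by case: fA => _ _; exact. Qed.

Lemma field_setU (S T : set X) : A S -> A T -> A (S `|` T).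
Proof. by case: fA => _ AU _; exact: AU. Qed.

Lemma field_setI (S T : set X) : A S -> A T -> A (S `&` T).
Proof.
move=> AS AT; rewrite -(setCK (S `&` T)) setCI; apply: field_setC.
by apply: field_setU; exact: field_setC.
Qed.

Lemma field_setD (S T : set X) : A S -> A T -> A (S `\` T).
Proof.
by move=> AS AT; rewrite setDE; apply: field_setI => //; exact: field_setC.
Qed.

Lemma field_set0 : A set0.
Proof. by case: fA => -[S AS] _ _; rewrite -(setDv S); exact: field_setD. Qed.

Lemma field_setT : A setT.
Proof. by rewrite -setC0; apply: field_setC; exact: field_set0. Qed.

(** The infinite distributive law of Boolean algebras, in the case of a zero
    meet: the complement of any [b] bounds C, so [b] is disjoint from T; hence
    the complement of T bounds B. *)
Lemma sup_in_disjoint (B C : set (set X)) (S T : set X) : B `<=` A ->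
  (forall b c, B b -> C c -> b `&` c = set0) ->
  is_sup_in A B S -> is_sup_in A C T -> S `&` T = set0.
Proof.
move=> BA BC [_ _ Smin] [AT _ Tmin].
apply/disjoints_subset; apply: Smin; first exact: field_setC.
move=> b Bb x bx Tx; move: bx; apply: (Tmin (~` b)) => //.
  exact/field_setC/BA.
by move=> c Cc; apply/disjoints_subset; rewrite setIC; exact: BC.
Qed.

(** The sets [F i] minus all earlier [F j] are disjoint and have the same union.
    They belong to A once the partial unions over proper initial segments do,
    which follows by transfinite induction: such a partial union is itself the
    union of the disjoint pieces below it. *)
Lemma field_bigcup_trivIset (J : eqType) :
  (forall F : J -> set X, (forall i, A (F i)) -> trivIset setT F ->
     A (\bigcup_i F i)) ->
  forall F : J -> set X, (forall i, A (F i)) -> A (\bigcup_i F i).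
Proof.
move=> Adisj F AF; have [lt [lt_trans lt_total minimal]] := strict_well_order J.
pose below i := \bigcup_(j in [set j | lt j i]) F j.
pose D i := F i `\` below i.
have D_triv : trivIset setT D.
  apply/trivIsetP => i j _ _ /lt_total lt_ij; rewrite -subset0 => x.
  move=> [[Fi nbi] [Fj nbj]]; case/orP: lt_ij => [lt_ij|lt_ji].
    by apply: nbj; exists i.
  by apply: nbi; exists j.
pose initial (P : set J) := forall i j, P i -> lt j i -> P j.
have D_cover (P : set J) : initial P ->
    \bigcup_(i in P) F i = \bigcup_(i in P) D i.
  move=> Pdown; apply/seteqP; split => x [i Pi]; last by move=> [Fix _]; exists i.
  move=> Fix; have [|j [Pj Fjx] minj] := minimal [set j | P j /\ F j x].
    by exists i.
  exists j => //; split=> // -[k /= lt_kj Fkx].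
  by apply: (minj k lt_kj); split => //; exact: Pdown lt_kj.
have A_cover (P : set J) : initial P ->
    (forall i, P i -> A (below i)) -> A (\bigcup_(i in P) F i).
  move=> Pdown Abelow; rewrite D_cover// bigcup_mkcond; apply: Adisj.
    move=> i; case: ifPn => [/set_mem Pi|_]; last exact: field_set0.
    by apply: field_setD => //; exact: Abelow.
  have [+ _] := trivIset_mkcond P D; apply.
  by move=> i j _ _; exact: D_triv.
have A_below i : A (below i).
  apply: contrapT => nAi.
  have [|m nAm minm] := minimal [set i | ~ A (below i)]; first by exists i.
  apply: nAm; apply: A_cover => [j k /= lt_jm lt_kj|j /minm/contrapT//].
  exact: lt_trans lt_kj lt_jm.
exact: A_cover.
Qed.

End FieldOfSets.

(** * Rings of measurable functions *)

Lemma ideal_scaleE (S : comPzRingType) (I : submodClosed S^o) (a : S)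
  (f : ideal_module I) : val (a *: f) = a * val f.
Proof. by []. Qed.

Lemma ideal_scaleC (S : comPzRingType) (I : submodClosed S^o)
  (f g : ideal_module I) : (val f : S) *: g = (val g : S) *: f.
Proof. by apply: val_inj; rewrite !ideal_scaleE mulrC. Qed.

Section MeasurableFunctions.
Variables (R : realType) (X : Type) (A : set (set X)) (fA : field_of_sets A).

(** A family with at most a continuum of members is extended along an injection
    of its index set into the reals, with empty sets at the other indices. *)
Lemma continuum_additiveP :
  continuum_additive A <->
  forall F : R -> set X, (forall r, A (F r)) -> A (\bigcup_r F r).
Proof.
split=> [addA F|addA I F leI AF]; first exact/addA/card_real_le.
have /pcard_injP[e e_inj] := card_le_trans leI (card_real_ge R).
pose G r := [set x | exists2 i, e i = r & F i x].
have -> : \bigcup_i F i = \bigcup_r G r.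
  apply/seteqP; split => x.
    by move=> [i _ Fix]; exists (e i) => //; exists i.
  by move=> [_ _ [i _ Fix]]; exists i.
apply: addA => r; have [[i <-]|none] := pselect (exists i, e i = r).
  have -> : G (e i) = F i; last exact: AF.
  apply/seteqP; split => x; last by move=> Fix; exists i.
  by move=> [j /e_inj <-//]; rewrite inE.
have -> : G r = set0; last exact: field_set0.
by rewrite -subset0 => x [i eir _]; apply: none; exists i.
Qed.

Lemma mfun_indic (E : set X) : A E -> mfun_field A R \1_E.
Proof.
move=> AE U _; rewrite preimage_indic.
do 2 case: ifP => _ //; first exact: field_setT.
- exact: field_setC.
- exact: field_set0.
Qed.

Lemma mfun_fiber (g : X -> R) r : mfun_field A R g -> A (g @^-1` [set r]).
Proof.
move=> Mg; rewrite -(setCK (g @^-1` _)); apply: field_setC => //.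
apply: (Mg (~` [set r])); apply: closed_openC.
exact/accessible_closed_set1/hausdorff_accessible/norm_hausdorff.
Qed.

Variables (addA : add_closed A R) (mulA : mul_closed A R).
Local Notation M := (mfun_ring fA addA mulA).

Lemma mfun_ringP (f : M) : mfun_field A R (val f).
Proof. exact/set_mem/valP. Qed.

Definition to_mfun (f : X -> R) (Mf : mfun_field A R f) : M :=
  Sub f (mem_set Mf).

(** * Self-injectivity makes the field complete and continuum additive *)

Section Conductor.
Variable h : X -> R.

Let conductor_pred (f : M^o) : bool := (val f \* h) \in mfun_field A R.

Let conductor_pred_closed : GRing.subsemimod_closed conductor_pred.
Proof.
split; first split.
- apply/mem_set; rewrite (_ : _ \* _ = cst 0); first exact: mfun_field_cst.
  by apply/funext => x; exact: mul0r.
- move=> f g Mf Mg; apply/mem_set.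
  rewrite (_ : _ \* _ = (val f \* h) \+ (val g \* h)).
    by apply: addA; exact/set_mem.
  by apply/funext => x; exact: mulrDl.
- move=> f g Mg; apply/mem_set.
  rewrite (_ : _ \* _ = val f \* (val g \* h)).
    by apply: mulA; [exact: mfun_ringP|exact/set_mem].
  by apply/funext => x; rewrite /= mulrA.
Qed.

Definition conductor : submodClosed M^o :=
  HB.pack conductor_pred
    (GRing.isSubmodClosed.Build M M^o conductor_pred conductor_pred_closed).

Lemma conductorP (f : ideal_module conductor) :
  mfun_field A R (val (val f) \* h).
Proof. exact/set_mem/(valP f). Qed.

Definition conductor_mul (f : ideal_module conductor) : M^o :=
  to_mfun (conductorP f).

Lemma conductor_mul_linear : linear conductor_mul.
Proof.
move=> a f g; apply/val_inj/funext => x /=.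
by rewrite mulrDl mulrA.
Qed.

HB.instance Definition _ := GRing.isLinear.Build M (ideal_module conductor)
  (M^o) *:%R conductor_mul conductor_mul_linear.

(** A linear endomorphism of the ring is multiplication by its value at 1. *)
Lemma self_injective_multiplier : self_injective M ->
  exists2 g : X -> R, mfun_field A R g &
    forall f, mfun_field A R f -> mfun_field A R (f \* h) -> f \* g = f \* h.
Proof.
move=> /(_ _ conductor_mul)[psi psiE].
exists (val (psi 1)) => [|f Mf Mfh]; first exact: mfun_ringP.
pose fI : ideal_module conductor := Sub (to_mfun Mf : M^o) (mem_set Mfh).
have := congr1 val (psiE fI) => /= <-.
have -> : to_mfun Mf = to_mfun Mf *: (1 : M^o) :> M^o by exact/esym/mulr1.
by rewrite linearZ /=.
Qed.

(** On a set [E] of A where [h] is constant, the indicator of [E] lies in the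
    conductor of [h] and can be cancelled. *)
Lemma self_injective_patch : self_injective M ->
  exists2 g : X -> R, mfun_field A R g &
    forall (E : set X) r, A E -> (forall x, E x -> h x = r) ->
      forall x, E x -> g x = r.
Proof.
move=> /self_injective_multiplier[g Mg gE]; exists g => // E r AE hE x Ex.
have Mh : mfun_field A R (\1_E \* h).
  rewrite (_ : _ \* _ = cst r \* \1_E).
    by apply: mulA; [exact: mfun_field_cst|exact: mfun_indic].
  apply/funext => y /=; rewrite indicE mulrC.
  by case: (boolP (y \in E)) => [/set_mem/hE->//|_]; rewrite !mulr0.
have := congr1 (fun k => k x) (gE _ (mfun_indic AE) Mh).
by rewrite /= indicE mem_set// !mul1r (hE x Ex).
Qed.

End Conductor.

(** The supremum of B is the set where the patch of the indicator of the union
    of B equals 1: off an upper bound of B, this patch is 0. *)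
Lemma self_injective_complete : self_injective M -> complete_field_of_sets A.
Proof.
move=> selfM B BA _; pose U := \bigcup_(T in B) T.
have [g Mg gE] := self_injective_patch (\1_U) selfM.
exists (g @^-1` [set 1]); split; first exact: mfun_fiber.
  move=> T BT; apply: gE; first exact: BA.
  by move=> x Tx; rewrite indicE mem_set//; exists T.
move=> T AT BleT x /= gx1; apply: contrapT => nTx.
have gx0 : g x = 0.
  apply: (gE (~` T)) => //; first exact: field_setC.
  by move=> y nTy; rewrite indicE memNset// => -[S /BleT ST /ST].
by move: gx1; rewrite gx0 => /esym/eqP; rewrite oner_eq0.
Qed.

(** The union is its own supremum in A: the fibers of the patch of the function
    equal to [r] on [F r] separate any further point from the whole family. *)
Lemma self_injective_bigcup_trivIset : self_injective M ->
  forall F : R -> set X, (forall r, A (F r)) -> trivIset setT F ->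
    A (\bigcup_r F r).
Proof.
move=> selfM F AF Fdisj.
have [||S [AS FS Smin]] := self_injective_complete selfM (B := range F).
- by move=> _ [r _ <-].
- by exists (F 0), 0.
have [g Mg gE] := self_injective_patch (fun x => xget 0 [set r | F r x]) selfM.
have gF r x : F r x -> g x = r.
  apply: gE => // y Fry; apply: xget_unique => // s Fsy.
  by apply: Fdisj => //; exists y.
suff -> : \bigcup_r F r = S by [].
apply/seteqP; split => x; first by move=> [r _]; apply: FS; exists r.
move=> Sx; apply: contrapT => nFx.
pose E := g @^-1` [set g x] `\` F (g x).
have : S `<=` ~` E.
  apply: Smin; first by apply: field_setC => //; apply: field_setD => //;
    exact: mfun_fiber.
  by move=> _ [r _ <-] y Fry [/= gyx]; rewrite -gyx (gF r y).
by move=> /(_ x Sx); apply; split => // Fx; apply: nFx; exists (g x).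
Qed.

(** * Completeness and continuum additivity make the ring self-injective *)

(** The homomorphism [phi] is multiplication by the quotient [phi f / f], which
    is a partial function common to all [f]; its level sets are completed to
    members of A by taking suprema. *)
Lemma complete_self_injective : complete_field_of_sets A ->
  (forall F : R -> set X, (forall r, A (F r)) -> A (\bigcup_r F r)) ->
  self_injective M.
Proof.
move=> complA Abigcup I phi.
pose num (f : ideal_module I) : X -> R := val (phi f).
pose den (f : ideal_module I) : X -> R := val (val f).
pose level r (f : ideal_module I) :=
  [set x | den f x != 0 /\ num f x = r * den f x].
have A_coz f : A [set x | den f x != 0].
  rewrite (_ : mkset _ = ~` (den f @^-1` [set 0])).
    apply: field_setC => //; exact/mfun_fiber/mfun_ringP.
  by apply/seteqP; split => x /= /eqP.
have A_level r f : A (level r f).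
  pose k : M := phi f - to_mfun (mfun_field_cst r fA) * val f.
  have kE : val k = (fun x => num f x - r * den f x) by [].
  rewrite (_ : level r f = [set x | den f x != 0] `&` (val k @^-1` [set 0])).
    by apply: field_setI => //; exact/mfun_fiber/mfun_ringP.
  rewrite kE; apply/seteqP; split => x [dx] /=.
    by move=> ->; rewrite subrr.
  by move=> /eqP; rewrite subr_eq0 => /eqP.
have numZ (a : M) f x : num (a *: f) x = val a x * num f x.
  by rewrite /num linearZ.
have denZ (a : M) f x : den (a *: f) x = val a x * den f x.
  by rewrite /den ideal_scaleE.
have cross f f' x : den f' x * num f x = den f x * num f' x.
  by rewrite -!numZ ideal_scaleC.
(* [f] is its own multiple by the indicator of its cozero set, and so is its
   image under [phi]. *)
have vanish f x : den f x = 0 -> num f x = 0.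
  move=> /eqP fx0; pose e : M := to_mfun (mfun_indic (A_coz f)).
  have eE y : val e y = (y \in [set x | den f x != 0])%:R by [].
  have ef : e *: f = f.
    apply/val_inj/val_inj/funext => y; apply: (etrans (denZ e f y)).
    have [fy0|fy_neq0] := eqVneq (den f y) 0; first by rewrite fy0 mulr0.
    by rewrite eE mem_set// mul1r.
  by rewrite -ef numZ eE memNset ?mul0r//= => /negP.
have /choice[S supS] r : exists S, is_sup_in A (range (level r)) S.
  apply: complA; first by move=> _ [f _ <-].
  by exists (level r 0), 0.
have S_uniq r s x : S r x -> S s x -> r = s.
  move=> Srx Ssx; apply: contrapT => neq_rs.
  suff SS0 : S r `&` S s = set0.
    by have := conj Srx Ssx : (S r `&` S s) x; rewrite SS0.
  apply: (sup_in_disjoint fA _ _ (supS r) (supS s)); first by move=> _ [f _ <-].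
  move=> _ _ [f _ <-] [f' _ <-]; rewrite -subset0 => y [[fy nf] [f'y nf']].
  apply: neq_rs; have := cross f f' y; rewrite nf nf'.
  rewrite mulrCA [X in _ = X]mulrCA [den f y * _]mulrC => /mulIf; apply.
  by rewrite mulf_neq0.
pose g x := xget 0 [set r | S r x].
have gE r x : S r x -> g x = r.
  by move=> Srx; apply: xget_unique => // s Ssx; exact: S_uniq Srx.
have Mg : mfun_field A R g.
  move=> U _.
  have AUS (P : set R) : A (\bigcup_(r in P) S r).
    rewrite bigcup_mkcond; apply: Abigcup => r.
    by case: ifP => _; [case: (supS r)|exact: field_set0].
  (* 0 is also the default value of [g], taken outside all the [S r]. *)
  have -> : g @^-1` U = (\bigcup_(r in U) S r) `|`
      (if 0 \in U then ~` (\bigcup_r S r) else set0).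
    apply/seteqP; split => x.
      rewrite /= {1}/g; case: xgetP => [r _ Srx Ur|none U0].
        by left; exists r.
      by right; rewrite mem_set//= => -[r _ /none].
    move=> [[r Ur Srx]|] /=; first by rewrite (gE _ _ Srx).
    case: ifP => // /set_mem U0 nS; rewrite /g; case: xgetP => // r _ Srx.
    by case: nS; exists r.
  apply: field_setU => //; case: ifP => _; last exact: field_set0.
  exact: field_setC.
exists ( *:%R (to_mfun Mg : M^o)) => f; apply/val_inj/funext => x.
suff : g x * den f x = num f x by [].
have [fx0|fx_neq0] := eqVneq (den f x) 0; first by rewrite fx0 mulr0 vanish.
pose r := num f x / den f x.
rewrite (gE r) ?divfK//; have [_ levelS _] := supS r.
by apply: (levelS (level r f)); [exists f|rewrite /level/= divfK].
Qed.

End MeasurableFunctions.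

Theorem theorem3p13 (R : realType) (X : Type) (X_neq0 : [set: X] !=set0)
    (A : set (set X)) (fA : field_of_sets A)
    (addA : add_closed A R) (mulA : mul_closed A R) :
  self_injective (mfun_ring fA addA mulA) <->
  complete_field_of_sets A /\ continuum_additive A.
Proof.
rewrite (continuum_additiveP R fA); split=> [selfM|[]].
  split; first exact: self_injective_complete selfM.
  apply: field_bigcup_trivIset => //.
  exact: self_injective_bigcup_trivIset selfM.
exact: complete_self_injective.
Qed.
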